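(* Let $n\ge 1$ be an integer, let $i_1,\dots,i_n$ be independent real random variables with $E(1+i_l)=1+j$ and $Var(1+i_l)=s^2$ for every $l$, where $j\in\mathbb{R}\setminus\{0,-1\}$, and let $1\le k\le n$. Let $p,q$ be real with $p>0$ and $p+(k-1)q>0$, and let $C_k$ be the final value of the annuity-due with annual payments $p,p+q,\dots,p+(k-1)q$. Then $$E(C_k)=({\ddot s}_a)^{(p,q)}_{\overline{k}|j},\qquad Var(C_k)=m_k-\mu_k^2,$$ where $$m_k=\frac{1}{d^2}\Big[(q-p)\big(d(p-q)(1+v)+2qv\big)\ddot s_{\overline{k}|f}-2q\big(d(p-q)(1+v)+qv\big)(I\ddot s)_{\overline{k}|f}-dq^2(1+v)(I^2\ddot s)_{\overline{k}|f}+2(p-q)\big(d(p-q)+q\big)(1+j)^k\ddot s_{\overline{k}|r}+2q\big(d(p-q)+q\big)(1+j)^k(I\ddot s)_{\overline{k}|r}\Big]$$ and $$\mu_k^2=\frac{p-q}{d}\Big(p-q+\frac{2q}{d}\Big)\Big(\ddot s_{\overline{2k}|j}-2\ddot s_{\overline{k}|j}\Big)-\frac{2q(p-q)k}{d}\ddot s_{\overline{k}|j}+\Big(\frac{q}{d}\Big)^2\Big((I\ddot s)_{\overline{2k}|j}-2(1+kd)(I\ddot s)_{\overline{k}|j}-k^2\Big).$$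
   Context: Final value: for annual payments $c_1,c_2,\dots$ the final value is defined by $C_1=(1+i_1)c_1$ and $C_k=(1+i_k)(C_{k-1}+c_k)$ for $k\ge 2$; here $c_l=p+(l-1)q$. For a positive integer $k$ and real $x$: $\ddot s_{\overline{k}|x}=\sum_{l=1}^k(1+x)^{k+1-l}$, $(I\ddot s)_{\overline{k}|x}=\sum_{l=1}^k l(1+x)^{k+1-l}$, $(I^2\ddot s)_{\overline{k}|x}=\sum_{l=1}^k l^2(1+x)^{k+1-l}$, $({\ddot s}_a)^{(p,q)}_{\overline{k}|x}=\sum_{l=1}^k(p+(l-1)q)(1+x)^{k+1-l}$. Constants: $d=j/(1+j)$, $v=1/(1+j)$, $f=2j+j^2+s^2$ (so $1+f=E[(1+i_l)^2]$), and $r$ is defined by $1+r=(1+f)/(1+j)$. *)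

(* Defs.v *)
From HB Require Import structures.
From mathcomp Require Import all_boot all_order all_algebra finmap.
From mathcomp Require Import all_classical all_reals all_analysis.

Set Implicit Arguments.
Unset Strict Implicit.
Unset Printing Implicit Defensive.

Import Order.TTheory GRing.Theory Num.Theory.

Local Open Scope classical_set_scope.
Local Open Scope ring_scope.

(* Mutual independence of the subfamily (X l), l in A: the product rule holds
   for every finite set of indices in A and all Borel sets. *)
Definition mutually_independent (d : measure_display) (T : measurableType d)
    (R : realType) (P : probability T R) (I : choiceType) (A : set I)
    (X : I -> {RV P >-> R}) : Prop :=
  forall (J : {fset I}) (B : I -> set R),
    [set` J] `<=` A -> (forall l, l \in J -> measurable (B l)) ->
    P (\bigcap_(l in [set` J]) (X l @^-1` B l)) =
    (\prod_(l <- J) P (X l @^-1` B l))%E.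

(* Payments c and rates i are indexed from 1; the values at 0 are not used.
   The convention C_0 = 0 makes the recursion uniform, see final_value1. *)
Fixpoint final_value (R : realType) (i c : nat -> R) (k : nat) : R :=
  if k is k'.+1 then (1 + i k) * (final_value i c k' + c k) else 0.

Lemma final_value1 (R : realType) (i c : nat -> R) :
  final_value i c 1 = (1 + i 1%N) * c 1%N.
Proof. by rewrite /= add0r. Qed.

Lemma final_valueS (R : realType) (i c : nat -> R) (k : nat) : (2 <= k)%N ->
  final_value i c k = (1 + i k) * (final_value i c k.-1 + c k).
Proof. by case: k. Qed.

Definition arith_payment (R : realType) (p q : R) (l : nat) : R :=
  p + (l%:R - 1) * q.

Section annuity_due_values.
Variable R : realType.
Implicit Types (k : nat) (x p q j s : R).

Definition sdd k x : R :=
  \sum_(1 <= l < k.+1) (1 + x) ^+ (k.+1 - l)%N.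

Definition Isdd k x : R :=
  \sum_(1 <= l < k.+1) l%:R * (1 + x) ^+ (k.+1 - l)%N.

Definition I2sdd k x : R :=
  \sum_(1 <= l < k.+1) l%:R ^+ 2 * (1 + x) ^+ (k.+1 - l)%N.

Definition sdda p q k x : R :=
  \sum_(1 <= l < k.+1) arith_payment p q l * (1 + x) ^+ (k.+1 - l)%N.

Definition rate_d j : R := j / (1 + j).
Definition rate_v j : R := 1 / (1 + j).
Definition rate_f j s : R := 2 * j + j ^+ 2 + s ^+ 2.
Definition rate_r j s : R := (1 + rate_f j s) / (1 + j) - 1.

Definition m_ p q j s k : R :=
  let d := rate_d j in let v := rate_v j in
  let f := rate_f j s in let r := rate_r j s in
  1 / d ^+ 2 *
  ((q - p) * (d * (p - q) * (1 + v) + 2 * q * v) * sdd k f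
   - 2 * q * (d * (p - q) * (1 + v) + q * v) * Isdd k f
   - d * q ^+ 2 * (1 + v) * I2sdd k f
   + 2 * (p - q) * (d * (p - q) + q) * (1 + j) ^+ k * sdd k r
   + 2 * q * (d * (p - q) + q) * (1 + j) ^+ k * Isdd k r).

(* The closed form denoted by mu_k ^ 2 (already squared). *)
Definition mu2_ p q j k : R :=
  let d := rate_d j in
  (p - q) / d * (p - q + 2 * q / d) * (sdd (2 * k)%N j - 2 * sdd k j)
  - 2 * q * (p - q) * k%:R / d * sdd k j
  + (q / d) ^+ 2 *
    (Isdd (2 * k)%N j - 2 * (1 + k%:R * d) * Isdd k j - k%:R ^+ 2).

End annuity_due_values.

(* Main.v *)
Require Import Defs.
From HB Require Import structures.
From mathcomp Require Import all_boot all_order all_algebra finmap.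
From mathcomp Require Import all_classical all_reals all_analysis.
From mathcomp Require Import measurable_realfun ring.

Set Implicit Arguments.
Unset Strict Implicit.
Unset Printing Implicit Defensive.

Import Order.TTheory GRing.Theory Num.Theory.

Local Open Scope classical_set_scope.
Local Open Scope ring_scope.

(* C_(k+1) = (1 + i_(k+1)) (C_k + c_(k+1)), where C_k depends on i_1, ..., i_k
   only and is therefore independent of i_(k+1), by Dynkin's pi-lambda theorem
   applied to the cylinder events.  Hence the moments obey
     E C_(k+1) = (1 + j) (E C_k + c),
     E C_(k+1)^2 = ((1 + j)^2 + s^2) (E C_k^2 + 2 c E C_k + c^2),
   with c = c_(k+1), and the closed forms satisfy the same recursions.  For m_k,
   the terms in r arise because (1 + j)(1 + r) = 1 + f, so that
   (1 + j)^k sdd k r and (1 + j)^k Isdd k r satisfy first-order recursions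
   driven by the powers of 1 + j occurring in E C_k. *)

(** * Independence of two variables and the expectation of their product *)

Definition indep_rv (d : measure_display) (T : measurableType d)
    (R : realType) (P : probability T R) (X Y : T -> R) : Prop :=
  forall A B : set R, measurable A -> measurable B ->
  P (X @^-1` A `&` Y @^-1` B) = (P (X @^-1` A) * P (Y @^-1` B))%E.

Lemma indep_rv_comp (d : measure_display) (T : measurableType d)
    (R : realType) (P : probability T R) (X Y : T -> R) (f g : R -> R) :
  measurable_fun [set: R] f -> measurable_fun [set: R] g ->
  indep_rv P X Y -> indep_rv P (f \o X) (g \o Y).
Proof.
move=> mf mg XY A B mA mB; apply: (XY (f @^-1` A) (g @^-1` B)).
  by rewrite -[X in measurable X]setTI; exact: mf.
by rewrite -[X in measurable X]setTI; exact: mg.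
Qed.

Section indep_rv_expectation.
Local Open Scope ereal_scope.
Context (d : measure_display) (T : measurableType d) (R : realType).
Context (P : probability T R) (X Y : {mfun T >-> R}).
Hypothesis XY : indep_rv P X Y.

Let Z_mfun := isMeasurableFun.Build _ _ _ _ (fun t => (X t, Y t))
  (measurable_fun_pair (@measurable_funPT _ _ _ _ X)
    (@measurable_funPT _ _ _ _ Y)).
Let Z : {mfun T >-> (R * R)%type} := HB.pack (fun t => (X t, Y t)) Z_mfun.

(** Independence says that the law of the pair agrees with the product of the two laws on measurable
    rectangles, and a measure with these values on rectangles is unique. *)
Let joint_distribution (f : R * R -> \bar R) :
  \int[distribution P Z]_z f z = \int[distribution P X \x distribution P Y]_z f z.
Proof.
apply: eq_measure_integral => A mA _.
apply/esym.
by apply: (product_measure_unique (m' := distribution P Z)) => // B C; exact: XY.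
Qed.

Hypotheses (X1 : (X : T -> R) \in Lfun P 1) (Y1 : (Y : T -> R) \in Lfun P 1).

Let mul (z : R * R) := (z.1 * z.2)%:E.

Let mmul : measurable_fun [set: R * R] mul.
Proof. by apply/measurable_EFinP; exact: measurable_funM. Qed.

Let integrable_distribution (V : {mfun T >-> R}) :
  (V : T -> R) \in Lfun P 1 ->
  (distribution P V).-integrable [set: R] (fun x => x%:E).
Proof.
move=> /Lfun1_integrable iV.
by apply: integrable_pushforward => //; exact/measurable_EFinP.
Qed.

Let expectation_distribution (V : {mfun T >-> R}) :
  (V : T -> R) \in Lfun P 1 -> \int[distribution P V]_x x%:E = 'E_P[V].
Proof.
move=> /Lfun1_integrable iV; rewrite unlock integral_distribution//.
Qed.

(** By Tonelli, the integral of [|x * y|] against the product law factors into the first absolute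
    moments of [X] and [Y], both finite. *)
Lemma indep_rv_Lfun1M : (X \* Y)%R \in Lfun P 1.
Proof.
apply/Lfun1_integrable/integrableP; split.
  by apply/measurable_EFinP; exact: measurable_funM.
have -> : \int[P]_t `|(X t * Y t)%:E| = \int[distribution P Z]_z `|mul z|.
  by rewrite ge0_integral_distribution//; exact: measurableT_comp.
rewrite joint_distribution (fubini_tonelli1 (abse \o mul)); last 2 first.
- exact: measurableT_comp.
- by move=> z; exact: abse_ge0.
rewrite /fubini_F/=.
under eq_integral => x _.
  under eq_integral => y _ do rewrite normrM EFinM.
  rewrite ge0_integralZl//; last exact: measurableT_comp.
  over.
rewrite ge0_integralZr//; last 2 first.
- exact: measurableT_comp.
- exact: integral_ge0.
have /integrableP[_ ?] := integrable_distribution X1.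
have /integrableP[_ ?] := integrable_distribution Y1.
apply: lte_mul_pinfty => //; first exact: integral_ge0.
by rewrite ge0_fin_numE//; exact: integral_ge0.
Qed.

(** Fubini for the product law; the integrability it requires comes from [indep_rv_Lfun1M]. *)
Lemma indep_rv_expectationM : 'E_P[X \* Y] = 'E_P[X] * 'E_P[Y].
Proof.
have iXY := indep_rv_Lfun1M.
have imul : (distribution P Z).-integrable [set: R * R] mul.
  by apply: integrable_pushforward => //; exact/Lfun1_integrable.
have -> : 'E_P[X \* Y] = \int[distribution P Z]_z mul z.
  by rewrite unlock integral_distribution//; exact/Lfun1_integrable.
rewrite joint_distribution -integral12_prod_meas1; last first.
  apply/integrableP; split=> //; rewrite -joint_distribution.
  by case/integrableP: imul.
rewrite /fubini_F/= /mul/=.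
under eq_integral => x _.
  under eq_integral => y _ do rewrite EFinM.
  rewrite integralZl//; last exact: integrable_distribution.
  (* The inner integral is written as a real constant so that [integralZr] can pull it out of the
     outer one. *)
  rewrite expectation_distribution// -(fineK (expectation_fin_num Y1)).
  over.
rewrite integralZr//; last exact: integrable_distribution.
by rewrite expectation_distribution// fineK// expectation_fin_num.
Qed.

End indep_rv_expectation.

(** This form for bare functions suits composites such as squares and final values: membership in
    [Lfun P 1] supplies the measurability needed to pack them. *)
Lemma Lfun1_indep_rvM (d : measure_display) (T : measurableType d)
    (R : realType) (P : probability T R) (X Y : T -> R) :
  indep_rv P X Y -> X \in Lfun P 1 -> Y \in Lfun P 1 ->
  X \* Y \in Lfun P 1 /\ 'E_P[X \* Y]%E = ('E_P[X] * 'E_P[Y])%E.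
Proof.
move=> XY X1 Y1.
have /set_mem mX := sub_Lfun_mfun X1; have /set_mem mY := sub_Lfun_mfun Y1.
pose X' : {mfun T >-> R} := HB.pack X (isMeasurableFun.Build _ _ _ _ X mX).
pose Y' : {mfun T >-> R} := HB.pack Y (isMeasurableFun.Build _ _ _ _ Y mY).
by split; [exact: (@indep_rv_Lfun1M _ _ _ _ X' Y')
          |exact: (@indep_rv_expectationM _ _ _ _ X' Y')].
Qed.

(** * Independence of the past from the next rate *)

Section cylinders.
Context (d : measure_display) (T : measurableType d) (R : realType).
Context (P : probability T R) (I : choiceType) (X : I -> {RV P >-> R}).

(** A pi-system generating the sigma-algebra of the [X l] with [l] in [J]. *)
Definition cylinders (J : {fset I}) : set (set T) :=
  [set E | exists2 B : I -> set R, (forall l, measurable (B l)) &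
     E = \bigcap_(l in [set` J]) (X l @^-1` B l)].

Lemma measurable_cylinder (J : {fset I}) : cylinders J `<=` measurable.
Proof.
move=> _ [B mB ->]; apply: fin_bigcap_measurable => // l _.
exact: measurable_funPTI.
Qed.

Lemma cylinders_setI (J : {fset I}) : setI_closed (cylinders J).
Proof.
move=> _ _ [B mB ->] [C mC ->].
exists (fun l => B l `&` C l) => [l|]; first exact: measurableI.
by rewrite -bigcapI.
Qed.

Lemma cylinders_setT (J : {fset I}) : cylinders J setT.
Proof.
by exists (fun=> setT) => //; apply/esym; rewrite -subTset => t _ l _.
Qed.

Lemma measurable_fun_cylinder (J : {fset I}) (l : I) : l \in J ->
  measurable_fun [set: g_sigma_algebraType (cylinders J)] (X l).
Proof.
move=> lJ _ B mB; rewrite setTI; apply: sub_sigma_algebra.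
exists (fun m => if m == l then B else setT) => [m|]; first by case: ifP.
apply/seteqP; split=> [t XB m _|t /(_ l lJ)] /=; last by rewrite eqxx.
by case: eqP => [->|].
Qed.

(** For fixed [B], both sides are finite measures in [E]: a restriction of [P] and a multiple of
    [P]. They agree on the cylinders, hence on the sigma-algebra these generate. *)
Lemma mutually_independent_cylinders (A : set I) (J : {fset I}) (k : I)
    (E : set T) (B : set R) :
  mutually_independent A X -> [set` J] `<=` A -> A k -> k \notin J ->
  <<s cylinders J >> E -> measurable B ->
  P (E `&` X k @^-1` B) = (P E * P (X k @^-1` B))%E.
Proof.
move=> indep JA Ak kJ sE mB.
have mXB : measurable (X k @^-1` B) by exact: measurable_funPTI.
have PXB : (P (X k @^-1` B) \is a fin_num)%E by exact: fin_num_measure.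
(* [mscale] takes its factor as a nonnegative real. *)
pose r := fine (P (X k @^-1` B)).
have r0 : 0 <= r by exact: fine_ge0.
rewrite muleC -(fineK PXB).
apply: (g_sigma_algebra_measure_unique (cylinders J)
  (@measurable_cylinder J) (fun=> setT) _ _ (mrestr P mXB)
  (mscale (NngNum r0) P) (@cylinders_setI J)) => //.
- by move=> _; exact: cylinders_setT.
- by rewrite -subTset => t _; exists 0%N.
- move=> _ [C mC ->].
  (* Since [k] is outside [J], the event at [k] and the cylinder merge into one cylinder over [k]
     and [J], to which the product rule applies. *)
  pose D l := if l == k then B else C l.
  have mD l : measurable (D l) by rewrite /D; case: ifP.
  have DJ l : l \in J -> D l = C l.
    by move=> lJ; rewrite /D; case: eqP => // lk; rewrite lk (negPf kJ) in lJ *.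
  have kJA : [set` (k |` J)%fset] `<=` A.
    by move=> l /=; rewrite !inE => /orP[/eqP->//|]; exact: JA.
  have := indep _ _ kJA (fun l _ => mD l).
  rewrite big_fsetU1//= {2}/D eqxx set_fsetU1 bigcap_setU1 {1}/D eqxx.
  rewrite (eq_bigcapr (G := fun l => X l @^-1` C l)); last first.
    by move=> l lJ; rewrite DJ.
  rewrite (eq_big_seq (fun l => P (X l @^-1` C l))); last first.
    by move=> l lJ; rewrite DJ.
  rewrite -(indep J C JA); last by [].
  by rewrite /mrestr /mscale setIC => ->; rewrite /= fineK.
- by move=> _; rewrite /= /mrestr setTI ltey_eq PXB.
Qed.

End cylinders.

(** The domain is an arbitrary measurable type, so that it can be taken to be [T] with the
    sigma-algebra generated by the first [k] rates. *)
Lemma measurable_final_value (d : measure_display) (T : measurableType d)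
    (R : realType) (X : nat -> T -> R) (c : nat -> R) (k : nat) :
  (forall l, (1 <= l <= k)%N -> measurable_fun [set: T] (X l)) ->
  measurable_fun [set: T] (fun t => final_value (X ^~ t) c k).
Proof.
elim: k => [|k IH] mX; first exact: measurable_cst.
apply: measurable_funM; first by apply: measurable_funD => //; apply: mX; rewrite leqnn.
apply: measurable_funD => //; apply: IH => l /andP[l1 lk].
by apply: mX; rewrite l1 ltnW.
Qed.

Lemma final_value_indep (d : measure_display) (T : measurableType d)
    (R : realType) (P : probability T R) (n : nat) (i : nat -> {RV P >-> R})
    (c : nat -> R) (k : nat) :
  mutually_independent [set l : nat | (1 <= l <= n)%N] i -> (k < n)%N ->
  indep_rv P (fun t => final_value (fun l => i l t) c k) (i k.+1).
Proof.
move=> indep kn A B mA mB.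
pose J := [fset l | l in iota 1 k]%fset.
have JE l : (l \in J) = (1 <= l <= k)%N by rewrite !inE /= mem_iota add1n ltnS.
apply: (mutually_independent_cylinders (J := J) indep) => //=.
- by move=> l /=; rewrite JE => /andP[-> lk]; rewrite (leq_trans lk)// ltnW.
- by rewrite JE ltnn andbF.
- have mJ l : (1 <= l <= k)%N ->
      measurable_fun [set: g_sigma_algebraType (cylinders i J)] (i l).
    by move=> lk; apply: measurable_fun_cylinder; rewrite JE.
  have mk := measurable_final_value
    (T := g_sigma_algebraType (cylinders i J)) c mJ.
  rewrite -[X in <<s _ >> X]setTI.
  exact: (mk measurableT A mA).
Qed.

(** * First and second moments *)

Section moments.
Context (d : measure_display) (T : measurableType d) (R : realType).
Context (P : probability T R).
Implicit Type X : T -> R.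

(* In mathcomp [+oo - +oo] is infinite, so that a finite expectation entails
   integrability. *)
Lemma fin_num_expectation_Lfun1 X : measurable_fun [set: T] X ->
  'E_P[X]%E \is a fin_num -> X \in Lfun P 1.
Proof.
move=> mX; rewrite unlock => EX; apply/Lfun1_integrable/integrableP.
split; first exact/measurable_EFinP.
by rewrite integral_fin_num_abs//; exact/measurable_EFinP.
Qed.

Lemma expectation_affine X (a b m : R) : X \in Lfun P 1 -> 'E_P[X]%E = m%:E ->
  (fun t => a * X t + b) \in Lfun P 1 /\
  'E_P[fun t => (a * X t + b)%R]%E = (a * m + b)%:E.
Proof.
move=> X1 EX.
have -> : (fun t => a * X t + b) = a \o* X \+ cst b.
  by apply/funext => t /=; rewrite mulrC.
have aX1 : a \o* X \in Lfun P 1 by exact: Lfun_scale.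
have b1 : cst b \in Lfun P 1 by exact: Lfun_cst.
split; first exact: rpredD.
by rewrite expectationD// expectationZl// EX expectation_cst EFinD EFinM.
Qed.

Lemma expectation_sqr_affine X (a m m2 : R) :
  X \in Lfun P 1 -> (fun t => X t ^+ 2) \in Lfun P 1 ->
  'E_P[X]%E = m%:E -> 'E_P[fun t => (X t ^+ 2)%R]%E = m2%:E ->
  (fun t => (X t + a) ^+ 2) \in Lfun P 1 /\
  'E_P[fun t => ((X t + a) ^+ 2)%R]%E = (m2 + 2 * a * m + a ^+ 2)%:E.
Proof.
move=> X1 X2 EX EX2.
have [Y1 EY] := expectation_affine (2 * a) (a ^+ 2) X1 EX.
have -> : (fun t => (X t + a) ^+ 2) =
    (fun t => X t ^+ 2) \+ (fun t => 2 * a * X t + a ^+ 2).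
  by apply/funext => t /=; ring.
split; first exact: rpredD.
by rewrite expectationD// EX2 EY -addrA EFinD.
Qed.

(** Finiteness of the mean and of the variance gives integrability of [X] and of its centred square;
    expanding the square of [(X - m) + m], where [X - m] has mean 0, gives the second moment. *)
Lemma expectation_sqr_variance X (m v : R) : measurable_fun [set: T] X ->
  'E_P[X]%E = m%:E -> 'V_P[X] = v%:E ->
  [/\ X \in Lfun P 1, (fun t => X t ^+ 2) \in Lfun P 1 &
      'E_P[fun t => (X t ^+ 2)%R]%E = (m ^+ 2 + v)%:E].
Proof.
move=> mX EX; rewrite /variance covariance.unlock EX/= => VX.
have X1 : X \in Lfun P 1 by apply: fin_num_expectation_Lfun1; rewrite ?EX.
have [Y1 EY] := expectation_affine 1 (- m) X1 EX.
have Y2E : ((X \- cst m) * (X \- cst m))%R = (fun t => (1 * X t - m) ^+ 2).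
  by apply/funext => t /=; rewrite mul1r.
rewrite Y2E in VX.
have Y2 : (fun t => (1 * X t - m) ^+ 2) \in Lfun P 1.
  apply: fin_num_expectation_Lfun1; last by rewrite VX.
  apply: measurable_funX; apply: measurable_funB => //.
  exact: measurable_funM.
have [] := expectation_sqr_affine m Y1 Y2 EY VX.
rewrite (_ : (fun t => _) = (fun t => X t ^+ 2)); last first.
  by apply/funext => t; rewrite mul1r subrK.
by move=> ? ->; split=> //; congr EFin; ring.
Qed.

End moments.

(** The moments are determined by their recursions, so [mu] and [m2] stay abstract until the closed
    forms are substituted. Integrability is carried along because the product rule needs it at the
    next step. *)
Lemma final_value_moments (d : measure_display) (T : measurableType d)
    (R : realType) (P : probability T R) (n : nat) (i : nat -> {RV P >-> R})
    (j s : R) (c mu m2 : nat -> R) :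
  mutually_independent [set l : nat | (1 <= l <= n)%N] i ->
  (forall l : nat, (1 <= l <= n)%N ->
    'E_P[fun t : T => (1 + i l t)%R]%E = (1 + j)%:E) ->
  (forall l : nat, (1 <= l <= n)%N ->
    'V_P[fun t : T => 1 + i l t] = (s ^+ 2)%:E) ->
  mu 0 = 0 -> (forall k, mu k.+1 = (1 + j) * (mu k + c k.+1)) ->
  m2 0 = 0 -> (forall k, m2 k.+1 =
    ((1 + j) ^+ 2 + s ^+ 2) * (m2 k + 2 * c k.+1 * mu k + c k.+1 ^+ 2)) ->
  forall k, (k <= n)%N ->
  let C := fun t => final_value (fun l => i l t) c k in
  [/\ C \in Lfun P 1, (fun t => C t ^+ 2) \in Lfun P 1,
      'E_P[C]%E = (mu k)%:E & 'E_P[fun t => (C t ^+ 2)%R]%E = (m2 k)%:E].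
Proof.
move=> indep Ei Vi mu0 muS m20 m2S; elim=> [_|k IH kn].
  (* The induction starts from the convention that [final_value] at 0 is the constant 0. *)
  rewrite /= expr0n/= mu0 m20 -[X in X \in _]/(cst 0).
  by split; rewrite ?expectation_cst//; exact: Lfun_cst.
have {IH}[] := IH (ltnW kn).
set D := fun t => final_value (fun l => i l t) c k => D1 D2 ED ED2.
have kn' : (1 <= k.+1 <= n)%N by [].
pose X t := 1 + i k.+1 t.
pose Y t := D t + c k.+1.
have mX : measurable_fun [set: T] X by exact: measurable_funD.
have [X1 X2 EX2] := expectation_sqr_variance mX (Ei _ kn') (Vi _ kn').
have [Y1 EY] : Y \in Lfun P 1 /\ 'E_P[Y]%E = (mu k + c k.+1)%:E.
  have := expectation_affine 1 (c k.+1) D1 ED.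
  by rewrite mul1r (_ : (fun t => _) = Y)//; apply/funext => t; rewrite mul1r.
have [Y2 EY2] := expectation_sqr_affine (c k.+1) D1 D2 ED ED2.
have YX : indep_rv P Y X.
  apply: (indep_rv_comp (f := fun x => x + c k.+1) (g := fun x => 1 + x));
    [| |exact: final_value_indep indep kn]; exact: measurable_funD.
have YX2 : indep_rv P (fun t => Y t ^+ 2) (fun t => X t ^+ 2).
  by apply: (indep_rv_comp (f := fun x => x ^+ 2) (g := fun x => x ^+ 2) _ _ YX);
    exact: measurable_funX.
have [C1 EC] := Lfun1_indep_rvM YX Y1 X1.
have [C2 EC2] := Lfun1_indep_rvM YX2 Y2 X2.
have CE : (fun t => final_value (fun l => i l t) c k.+1) = Y \* X.
  by apply/funext => t; rewrite /= mulrC.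
have C2E : (fun t => final_value (fun l => i l t) c k.+1 ^+ 2) =
    (fun t => Y t ^+ 2) \* (fun t => X t ^+ 2).
  by apply/funext => t; rewrite /= -exprMn mulrC.
move=> C; rewrite /C C2E CE; split=> //.
  by rewrite EC EY (Ei _ kn') -EFinM mulrC muS.
by rewrite EC2 EY2 EX2 -EFinM mulrC m2S.
Qed.

(** * Recursions and closed forms of the annuity values *)

Lemma sum_powS (R : realType) (a : nat -> R) (y : R) (k : nat) :
  \sum_(1 <= l < k.+2) a l * y ^+ (k.+2 - l) =
  y * (\sum_(1 <= l < k.+1) a l * y ^+ (k.+1 - l) + a k.+1).
Proof.
rewrite big_nat_recr//= subSnn expr1 mulrDr big_distrr/= [y * a _]mulrC.
congr (_ + _); rewrite big_nat_cond [RHS]big_nat_cond; apply: eq_bigr => l.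
by rewrite andbT => /andP[_ /ltnW lk]; rewrite (subSn lk) exprS mulrCA.
Qed.

Section closed_forms.
Variable R : realType.
Implicit Types (x p q j s : R) (k : nat).

Lemma sdda0 p q x : sdda p q 0 x = 0. Proof. by rewrite /sdda big_geq. Qed.
Lemma sdd0 x : sdd 0 x = 0. Proof. by rewrite /sdd big_geq. Qed.
Lemma Isdd0 x : Isdd 0 x = 0. Proof. by rewrite /Isdd big_geq. Qed.
Lemma I2sdd0 x : I2sdd 0 x = 0. Proof. by rewrite /I2sdd big_geq. Qed.

Lemma sddaS p q k x :
  sdda p q k.+1 x = (1 + x) * (sdda p q k x + arith_payment p q k.+1).
Proof. exact: sum_powS. Qed.

Lemma sddS k x : sdd k.+1 x = (1 + x) * (sdd k x + 1).
Proof.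
rewrite /sdd; under eq_bigr do rewrite -[_ ^+ _]mul1r.
rewrite (sum_powS (fun=> 1)).
by under eq_bigr do rewrite mul1r.
Qed.

Lemma IsddS k x : Isdd k.+1 x = (1 + x) * (Isdd k x + k.+1%:R).
Proof. exact: (sum_powS (fun l => l%:R)). Qed.

Lemma I2sddS k x : I2sdd k.+1 x = (1 + x) * (I2sdd k x + k.+1%:R ^+ 2).
Proof. exact: (sum_powS (fun l => l%:R ^+ 2)). Qed.

Section nondegenerate_rate.
Variable j : R.
Hypotheses (j0 : j != 0) (j1 : 1 + j != 0).

Lemma sddE k : sdd k j = (1 + j) * ((1 + j) ^+ k - 1) / j.
Proof.
elim: k => [|k IH]; first by rewrite sdd0 expr0 subrr mulr0 mul0r.
by rewrite sddS IH exprS; field.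
Qed.

Lemma IsddE k : Isdd k j = (1 + j) * (sdd k j - k%:R) / j.
Proof.
elim: k => [|k IH]; first by rewrite Isdd0 sdd0 subrr mulr0 mul0r.
by rewrite IsddS sddS IH -(natr1 k); field.
Qed.

Lemma sddaE p q k : sdda p q k j = (p - q) * sdd k j + q * Isdd k j.
Proof.
elim: k => [|k IH]; first by rewrite sdda0 sdd0 Isdd0; ring.
by rewrite sddaS sddS IsddS IH /arith_payment; ring.
Qed.

(** Once the sums at [j] are in closed form, the power with exponent [2 * k] is the square of
    [(1 + j) ^+ k], and the claim is an identity of rational functions in [j], [k%:R] and that
    power. *)
Lemma mu2_sdda p q k : mu2_ p q j k = sdda p q k j ^+ 2.
Proof.
rewrite /mu2_ sddaE !IsddE !sddE /rate_d mulnC exprM natrM.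
by field; rewrite j0 j1.
Qed.

Lemma m_0 p q s : m_ p q j s 0 = 0.
Proof. by rewrite /m_ !sdd0 !Isdd0 I2sdd0; ring. Qed.

(** The sums at [f] and [r] with index [k] act as free variables; those at [j], coming from the
    mean, are eliminated by their closed forms. What remains is a field identity with denominators
    [j] and [1 + j]. *)
Lemma m_S p q s k : let c := arith_payment p q k.+1 in
  m_ p q j s k.+1 =
  ((1 + j) ^+ 2 + s ^+ 2) *
    (m_ p q j s k + 2 * c * sdda p q k j + c ^+ 2).
Proof.
rewrite /m_ /arith_payment !sddS !IsddS I2sddS sddaE IsddE sddE.
rewrite /rate_r subrKC /rate_f /rate_d /rate_v (exprS _ k) -(natr1 k).
by field; rewrite j0 j1.
Qed.

End nondegenerate_rate.
End closed_forms.

Theorem theorem3p1 (d : measure_display) (T : measurableType d) (R : realType)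
  (P : probability T R) (n : nat) (i : nat -> {RV P >-> R})
  (j s : R) (k : nat) (p q : R) :
  (1 <= n)%N ->
  mutually_independent [set l : nat | (1 <= l <= n)%N] i ->
  (forall l : nat, (1 <= l <= n)%N ->
    'E_P[fun t : T => (1 + i l t)%R]%E = (1 + j)%:E) ->
  (forall l : nat, (1 <= l <= n)%N ->
    'V_P[fun t : T => 1 + i l t] = (s ^+ 2)%:E) ->
  j <> 0 -> j <> -1 ->
  (1 <= k <= n)%N ->
  0 < p -> 0 < p + (k%:R - 1) * q ->
  let C : T -> R :=
    fun t => final_value (fun l => i l t) (arith_payment p q) k in
  'E_P[C]%E = (sdda p q k j)%:E /\
  'V_P[C] = (m_ p q j s k - mu2_ p q j k)%:E.
Proof.
move=> _ indep Ei Vi /eqP j0 /eqP jN1 /andP[_ kn] _ _ C.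
have j1 : 1 + j != 0 by rewrite addrC addr_eq0.
have [C1 C2 EC EC2] := final_value_moments indep Ei Vi (sdda0 p q j)
  (fun k => sddaS p q k j) (m_0 j p q s) (m_S j0 j1 p q s) kn.
split=> //.
have sqrC : (C * C)%R = (fun t => C t ^+ 2) by apply/funext => t.
(* The variance is the second moment minus the squared mean, and [mu2_sdda] identifies the latter
   with [mu2_]. *)
by rewrite /variance covarianceE// sqrC ?EC2 ?EC// mu2_sdda// expr2 EFinB EFinM.
Qed.
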